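(* For every positive integer $k$, the following identity of formal power series in $q$ (equivalently, of analytic functions for $|q|<1$) holds: \[ q^{-k} - q^{-2k} + \frac{1 - q^{-k} + q^{-2k}}{ (q;q)_{\infty} } \left( \frac{ (-1)^{k} q^{\frac{k(3k-1)}{2}} }{1 - q^{k} + q^{2k}} - 1 + \sum_{j=0}^{k-1} (-1)^{j} q^{\frac{j(3j-1)}{2}} \left( 1 + q^{j} \right) \right) = 1 + (-1)^{k-1} \sum_{n = 1}^{\infty} \frac{ q^{\binom{k}{2} + (k + 1) n } }{ (q; q)_{n}\, [ n + 1 ]_{q} } \begin{bmatrix} n - 1 \\ k - 1 \end{bmatrix}_{q}. \]
   Context: The $q$-Pochhammer symbol is $(a;q)_n=\prod_{i=0}^{n-1}(1-aq^i)$ for integers $n\ge 0$ and $(a;q)_\infty=\prod_{i=0}^{\infty}(1-aq^i)$. The $q$-binomial coefficient is $\begin{bmatrix} n \\ k \end{bmatrix}_{q}=\frac{(q;q)_n}{(q;q)_k(q;q)_{n-k}}$ if $0\le k\le n$ and $0$ otherwise. The $q$-bracket is $[n]_q=\frac{1-q^n}{1-q}$. *)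

(* Defs.v *)
(* MathComp / MathComp-Analysis. *)
From mathcomp Require Import all_boot all_order all_algebra.
From mathcomp Require Import complex.
From mathcomp Require Import all_classical all_reals all_analysis.
Set Implicit Arguments.
Unset Strict Implicit.
Unset Printing Implicit Defensive.
Import Order.TTheory GRing.Theory Num.Theory.
Import numFieldNormedType.Exports.
Local Open Scope classical_set_scope.
Local Open Scope ring_scope.

Definition qpoch (K : numFieldType) (a q : K) (n : nat) : K :=
  \prod_(i < n) (1 - a * q ^+ i).

(* Only meaningful when the partial products converge, e.g. for `|q| < 1. *)
Definition qpoch_oo (K : numFieldType) (a q : K) : K := limn (qpoch a q).

Definition qbinom (K : numFieldType) (q : K) (n k : nat) : K :=
  if (k <= n)%N then qpoch q q n / (qpoch q q k * qpoch q q (n - k)) else 0.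

Definition qbracket (K : numFieldType) (q : K) (n : nat) : K :=
  (1 - q ^+ n) / (1 - q).

(* Used only for k, n >= 1, so that the predecessors are honest subtractions. *)
Definition qsummand (K : numFieldType) (q : K) (k n : nat) : K :=
  q ^+ ('C(k, 2) + (k + 1) * n) / (qpoch q q n * qbracket q (n + 1))
  * qbinom q n.-1 k.-1.

(* Main.v *)
(* Write P = (q;q)_oo, f_a = sum_m q^(am) / (q;q)_m and
   G(k, a) = sum_m q^(am) / ((1 - q^(m+k)) (q;q)_m).
   Telescoping gives f_1 = 1 / P, and f_(a+1) = (1 - q^a) f_a, hence Euler's
   f_a = (q;q)_(a-1) / P.  Comparing terms,
     G(k, a) - q^k G(k, a+1) = f_a  and  G(k, a) - G(k, a+1) = q^a G(k+1, a),
   so G(k+1, k+2) is an affine function of G(k, k+1); by induction on k this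
   yields the Andrews-Merca truncation of the pentagonal number theorem, which
   evaluates G(k, k+1).  By the partial fractions
     (1 - q) / ((1 - x) (1 - q x)) = 1 / (1 - x) - q / (1 - q x),  x = q^n,
   the series of the theorem is
   q^(k(3k+1)/2) / (q;q)_(k-1) * (G(k, k+1) - q G(k+1, k+1)).
   Convergence in the complex plane comes from 1 / (q;q)_n being bounded. *)
Require Import Defs.
From mathcomp Require Import all_boot all_order all_algebra.
From mathcomp Require Import complex.
From mathcomp Require Import all_classical all_reals all_analysis.
From mathcomp Require Import ring lra.
Import Order.TTheory GRing.Theory Num.Theory.
Import numFieldNormedType.Exports.
Local Open Scope classical_set_scope.
Local Open Scope ring_scope.
Set Implicit Arguments.
Unset Strict Implicit.

(** * Finite [q]-Pochhammer products *)

Lemma qpochS (K : numFieldType) (a q : K) n :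
  qpoch a q n.+1 = qpoch a q n * (1 - a * q ^+ n).
Proof. by rewrite /qpoch big_ord_recr. Qed.

Lemma qpoch0 (K : numFieldType) (a q : K) : qpoch a q 0 = 1.
Proof. by rewrite /qpoch big_ord0. Qed.

Lemma subX1_neq0 (K : numFieldType) (q : K) n : `|q| < 1 -> 1 - q ^+ n.+1 != 0.
Proof.
move=> q1; rewrite subr_eq0; apply/eqP => /(congr1 Num.norm)/eqP.
by rewrite normr1 normrX gt_eqF// exprn_ilt1.
Qed.

Lemma qpoch_neq0 (K : numFieldType) (q : K) n : `|q| < 1 -> qpoch q q n != 0.
Proof.
by move=> q1; apply/prodf_neq0 => i _; rewrite -exprS subX1_neq0.
Qed.

(** * Arithmetic of convergent series *)

(** Convergence and value are packed together, so that series identities reduce to termwise ones;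
    [K^o] views [K] as a normed module over itself. *)
Definition sums_to (K : numFieldType) (u : nat -> K) (l : K) : Prop :=
  (series u : nat -> K^o) @ \oo --> (l : K^o).

Lemma sums_to_unique (K : numFieldType) (u : nat -> K) l m :
  sums_to u l -> sums_to u m -> l = m.
Proof. by move=> ul um; apply: (@cvg_unique K^o _ _ _ _ _ ul um); exact: norm_hausdorff. Qed.

Lemma sums_toD (K : numFieldType) (u v : nat -> K) l m :
  sums_to u l -> sums_to v m -> sums_to (fun n => u n + v n) (l + m).
Proof.
move=> ul vm; rewrite /sums_to.
suff -> : series (fun n => u n + v n) = (series u : nat -> K^o) \+ series v.
  exact: cvgD.
by apply/funext => n; rewrite /series /= big_split.
Qed.

Lemma sums_toZ (K : numFieldType) (c : K) (u : nat -> K) l :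
  sums_to u l -> sums_to (fun n => c * u n) (c * l).
Proof.
move=> ul; rewrite /sums_to.
suff -> : series (fun n => c * u n) = (fun n => c * (series u n : K^o)).
  by apply: cvgM => //; exact: cvg_cst.
by apply/funext => n; rewrite /series /= mulr_sumr.
Qed.

Arguments sums_toZ {K} c {u l}.

Lemma sums_to_shift (K : numFieldType) (u : nat -> K) l :
  sums_to (fun n => u n.+1) l -> sums_to u (u 0 + l).
Proof.
move=> ul; rewrite /sums_to -(@cvg_shiftn 1 K^o).
suff -> : (fun n => series u (n + 1)%N) = (fun n => (u 0 : K^o) + series (fun n => u n.+1) n).
  by apply: cvgD => //; exact: cvg_cst.
by apply/funext => n; rewrite /series /= addn1 big_nat_recl.
Qed.

Lemma eq_sums_to (K : numFieldType) (u v : nat -> K) l m :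
  sums_to u l -> u =1 v -> l = m -> sums_to v m.
Proof. by move=> ul /funext <- <-. Qed.

(** * Bounds and convergence in the complex plane *)

(** Each factor is at most [1 + r ^+ i / (1 - r)], hence at most the exponential of
    [r ^+ i / (1 - r)]; these exponents form a geometric series of sum [1 / (1 - r) ^+ 2]. *)
Lemma prodV_1subX_bounded (R : realType) (r : R) : 0 <= r -> r < 1 ->
  exists C : R, forall n, \prod_(i < n) (1 - r ^+ i.+1)^-1 <= C.
Proof.
move=> r0 r1; have s0 : 0 < 1 - r by lra.
exists (expR ((1 - r)^-1 / (1 - r))) => n.
apply: (@le_trans _ _ (\prod_(i < n) expR (r ^+ i / (1 - r)))).
  apply: ler_prod => i _.
  have ri0 : 0 <= r ^+ i by apply: exprn_ge0.
  have ri1 : r ^+ i <= 1 by apply: exprn_ile1 => //; lra.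
  have le_rS : r ^+ i.+1 <= r by rewrite exprS ler_piMr.
  have le_rS' : r ^+ i.+1 <= r ^+ i by rewrite exprS ler_piMl// ltW.
  have d0 : 0 < 1 - r ^+ i.+1 by lra.
  rewrite invr_ge0 (ltW d0) /=.
  apply: le_trans (expR_ge1Dx _).
  rewrite -[leLHS]div1r ler_pdivrMr// mulrDl mul1r.
  have : r ^+ i <= r ^+ i / (1 - r) * (1 - r ^+ i.+1).
    rewrite mulrAC ler_pdivlMr// ler_wpM2l//; lra.
  lra.
rewrite -expR_sum ler_expR -mulr_suml ler_wpM2r ?invr_ge0 ?(ltW s0)//.
rewrite -[leRHS]div1r ler_pdivlMr//.
have := subrX1 r n; have : 0 <= r ^+ n by apply: exprn_ge0.
set S := \sum_(_ < _) _ => rn0 E.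
have -> : S * (1 - r) = - ((r - 1) * S) by ring.
rewrite -E; lra.
Qed.

Lemma cvg_complex (R : realType) (u : nat -> R[i]) (a b : R) :
  (fun n => complex.Re (u n)) @ \oo --> a -> (fun n => complex.Im (u n)) @ \oo --> b ->
  (u : nat -> R[i]^o) @ \oo --> (Complex a b : R[i]^o).
Proof.
move=> ua ub; apply/(@cvgrPdist_lt _ R[i]^o) => e.
(* In the partial order of [R[i]], a positive [e] is real, so half of its real part can be allotted
   to each coordinate. *)
rewrite ltcE /= => /andP[/eqP Ime e0].
have e20 : 0 < complex.Re e / 2 by rewrite divr_gt0.
have eE : e = (complex.Re e)%:C%C by rewrite [LHS]complexE Ime /= mulr0 addr0.
move/cvgrPdist_lt : ua => /(_ _ e20) ua.
move/cvgrPdist_lt : ub => /(_ _ e20) ub.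
near=> n; rewrite eE.
have -> : Complex a b - u n = (a - complex.Re (u n))%:C%C + 'i%C * (b - complex.Im (u n))%:C%C.
  by rewrite [LHS]complexE; case: (u n).
apply: (le_lt_trans (ler_normD _ _)).
have -> : `|'i%C * (b - complex.Im (u n))%:C%C| = `|b - complex.Im (u n)|%:C%C :> R[i].
  by rewrite normrM !normc_def /= !expr0n /= !add0r !addr0 expr1n sqrtr1 mul1r sqrtr_sqr.
rewrite [X in X + _]normc_def /= expr0n addr0 sqrtr_sqr -rmorphD ltcR.
rewrite [ltRHS]splitr ltrD//.
  by near: n.
by near: n.
Unshelve. all: by end_near. Qed.

(** Real and imaginary parts are compared with the geometric series separately, over [R]. *)
Lemma cvg_series_geo (R : realType) (u : nat -> R[i]) (C r : R) :
  0 <= r -> r < 1 -> (forall n, `|u n| <= (C * r ^+ n)%:C%C) ->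
  cvgn (series u : nat -> R[i]^o).
Proof.
move=> r0 r1 u_le.
have C0 : 0 <= C.
  have := le_trans (normr_ge0 _) (u_le 0); by rewrite expr0 mulr1 ler0c.
have cvgR (f : nat -> R) : (forall n, `|f n| <= C * r ^+ n) -> cvgn (series f).
  move=> f_le; apply: (@normed_cvg R R^o).
  apply: (@series_le_cvg R (fun n => `|f n|) (fun n => C * r ^+ n)) => //.
    by move=> n; rewrite mulr_ge0// exprn_ge0.
  apply: (@is_cvg_geometric_series R C r); by rewrite ger0_norm.
have reu : cvgn (series (fun n => complex.Re (u n))).
  apply: cvgR => n; rewrite -lecR; exact: le_trans (normc_ge_Re _) (u_le n).
have imu : cvgn (series (fun n => complex.Im (u n))).
  (* Multiplying by ['i] turns the imaginary part into minus a real part without changing the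
     modulus. *)
  apply: cvgR => n; rewrite -lecR -normrN -ReiNIm.
  apply: le_trans (normc_ge_Re _) _.
  suff -> : `|u n * 'i%C| = `|u n| by [].
  by rewrite normrM [X in _ * X]normc_def /= expr0n add0r expr1n sqrtr1 mulr1.
have ReS n : complex.Re (series u n) = series (fun n => complex.Re (u n)) n.
  by rewrite /series /= (raddf_sum (@complex.Re R : Rcomplex R -> R)).
have ImS n : complex.Im (series u n) = series (fun n => complex.Im (u n)) n.
  by rewrite /series /= (raddf_sum (@complex.Im R : Rcomplex R -> R)).
apply/cvg_ex; exists (Complex (limn (series (fun n => complex.Re (u n))))
                              (limn (series (fun n => complex.Im (u n))))).
apply: cvg_complex; [under eq_fun do rewrite ReS | under eq_fun do rewrite ImS] => //.
Qed.

Lemma norm_lt1_real (R : realType) (q : R[i]) : `|q| < 1 ->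
  exists r : R, [/\ `|q| = r%:C%C, 0 <= r & r < 1].
Proof.
move=> q1; have /complex_realP[r qr] : `|q| \is Num.real by apply: normr_real.
by exists r; rewrite -ler0c -ltcR -qr.
Qed.

(** With [x = r ^+ i.+1], each factor has modulus between [1 - x] and [1 + x], and
    [1 + x <= 1 / (1 - x)]. So one product of the [1 / (1 - x)] bounds both quantities. *)
Lemma norm_qpoch_bounds (R : realType) (q : R[i]) : `|q| < 1 ->
  exists C : R, forall n,
    `|qpoch q q n| <= C%:C%C /\ `|(qpoch q q n)^-1| <= C%:C%C.
Proof.
move=> /norm_lt1_real[r [qr r0 r1]].
have [C leC] := prodV_1subX_bounded r0 r1.
have qXE i : `|q * q ^+ i| = (r ^+ i.+1)%:C%C by rewrite -exprS normrX qr rmorphXn.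
have rX_lt1 i : r ^+ i.+1 < 1 by rewrite exprn_ilt1.
have rX_ge0 i : 0 <= r ^+ i.+1 by rewrite exprn_ge0.
have d_gt0 i : 0 < 1 - r ^+ i.+1 by rewrite subr_gt0.
exists C => n; split.
  apply: (@le_trans _ _ (\prod_(i < n) (1 - r ^+ i.+1)^-1)%:C%C); last by rewrite lecR.
  rewrite normr_prod rmorph_prod; apply: ler_prod => i _.
  rewrite normr_ge0 /=; apply: le_trans (ler_normB _ _) _.
  rewrite normr1 qXE -[1]/(1%:C%C) -rmorphD lecR -[leRHS]div1r ler_pdivlMr//.
  rewrite mulrC -subr_sqr expr1n gerBl sqr_ge0 //.
apply: (@le_trans _ _ (\prod_(i < n) (1 - r ^+ i.+1)^-1)%:C%C); last by rewrite lecR.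
rewrite normfV normr_prod -prodfV rmorph_prod; apply: ler_prod => i _.
rewrite invr_ge0 normr_ge0 /= fmorphV lef_pV2.
- have E : (1 - r ^+ i.+1)%:C%C = 1 - `|q * q ^+ i| by rewrite qXE rmorphB rmorph1.
  rewrite [leLHS]E -[X in X - _](@normr1 R[i]); exact: lerB_dist.
- rewrite posrE normr_gt0; apply/eqP => /(congr1 (fun z => `|1 - z|)).
  rewrite opprB addrC subrK subr0 normr1 qXE => /eqP.
  by rewrite -[1]/(1%:C%C) (inj_eq (@complexI _)) lt_eqF.
- by rewrite posrE ltcR.
Qed.

Lemma cvg_cstD (K : numFieldType) (c : K) (u : nat -> K) l :
  (u : nat -> K^o) @ \oo --> (l : K^o) ->
  (fun n => c + u n : K^o) @ \oo --> (c + l : K^o).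
Proof. by move=> ul; apply: cvgD => //; exact: cvg_cst. Qed.

(** Serves to show that the infinite product is nonzero: its reciprocals converge as well. *)
Lemma cvg_invr_mul1 (K : numFieldType) (u : nat -> K) (l m : K) :
  (forall n, u n != 0) -> (u : nat -> K^o) @ \oo --> (l : K^o) ->
  (fun n => (u n)^-1 : K^o) @ \oo --> (m : K^o) -> l * m = 1.
Proof.
move=> u0 ul um.
have h1 : (fun _ : nat => 1 : K^o) @ \oo --> (l * m : K^o).
  suff -> : (fun _ : nat => 1 : K^o) = (fun n => (u n : K^o) * (u n)^-1) by exact: cvgM.
  by apply/funext => n; rewrite divff.
apply: (@cvg_unique K^o _ _ _ _ _ h1); [exact: norm_hausdorff | exact: cvg_cst].
Qed.

Lemma limn_eq (K : numFieldType) (u : nat -> K) (l : K) :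
  (u : nat -> K^o) @ \oo --> (l : K^o) -> limn (u : nat -> K^o) = l.
Proof. by move=> ul; apply: (@cvg_lim K^o) => //; exact: norm_hausdorff. Qed.

(** * The infinite product and Euler's series *)

(** Telescoping: the [m]-th term is [1 / (q;q)_(m+1) - 1 / (q;q)_m]. *)
Lemma invr_qpochE (K : numFieldType) (q : K) n : `|q| < 1 ->
  1 + series (fun m => q ^+ m.+1 / qpoch q q m.+1) n = (qpoch q q n)^-1.
Proof.
move=> q1; elim: n => [|n IHn].
  by rewrite /series /= big_geq// addr0 qpoch0 invr1.
rewrite seriesSr addrA IHn qpochS -exprS.
by field; rewrite subX1_neq0// qpoch_neq0.
Qed.

(** Both sequences are partial sums of series whose terms are [q ^+ n.+1] times a bounded factor,
    hence converge geometrically. *)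
Lemma qpoch_cvg (R : realType) (q : R[i]) : `|q| < 1 ->
  [/\ cvgn (qpoch q q : nat -> R[i]^o), qpoch_oo q q != 0 &
      (fun n => (qpoch q q n)^-1 : R[i]^o) @ \oo --> ((qpoch_oo q q)^-1 : R[i]^o)].
Proof.
move=> q1; have [C leC] := norm_qpoch_bounds q1.
have [r [qr r0 r1]] := norm_lt1_real q1.
have C0 : 0 <= C by have [/(le_trans (normr_ge0 _))] := leC 0%N; rewrite ler0c.
have geo (u : nat -> R[i]) : (forall n, `|u n| <= C%:C%C) ->
    cvgn (series (fun n => q ^+ n.+1 * u n) : nat -> R[i]^o).
  move=> leu; apply: (@cvg_series_geo _ _ C r) => // n.
  have qn : `|q ^+ n.+1| <= (r ^+ n)%:C%C.
    by rewrite normrX qr -(rmorphXn (real_complex R)) lecR ler_wiXn2l// ltW.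
  by rewrite normrM mulrC (rmorphM (real_complex R)) ler_pM.
have /cvg_ex[/= l ul] : cvgn (qpoch q q : nat -> R[i]^o).
  have /cvg_ex[/= l ul] := geo (fun n => - qpoch q q n) (fun n =>
    etrans (congr1 (fun z => z <= C%:C%C) (normrN _)) (leC n).1).
  apply/cvg_ex; exists (1 + l).
  suff -> : qpoch q q = (fun n => 1 + series (fun n => q ^+ n.+1 * - qpoch q q n) n).
    exact: cvg_cstD.
  apply/funext; elim=> [|n IHn]; first by rewrite /series /= big_geq// qpoch0 addr0.
  by rewrite seriesSr addrA -IHn qpochS -exprS; ring.
have /cvg_ex[/= v vl] : cvgn (fun n => (qpoch q q n)^-1 : R[i]^o).
  have /cvg_ex[/= v vl] := geo (fun n => (qpoch q q n.+1)^-1) (fun n => (leC n.+1).2).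
  apply/cvg_ex; exists (1 + v).
  suff -> : (fun n => (qpoch q q n)^-1) =
     (fun n => 1 + series (fun m => q ^+ m.+1 / qpoch q q m.+1) n).
    exact: cvg_cstD.
  by apply/funext => n; rewrite invr_qpochE.
have ooE : qpoch_oo q q = l := limn_eq ul.
have lv : l * v = 1 by apply: cvg_invr_mul1 ul vl => n; exact: qpoch_neq0.
have l0 : l != 0.
  by apply/eqP => l0; move: lv; rewrite l0 mul0r => /eqP; rewrite eq_sym oner_eq0.
have vE : v = l^-1 by rewrite -[LHS](mulKf l0) lv mulr1.
rewrite ooE -vE; split; [apply/cvg_ex; exists l; exact: ul | exact: l0 | exact: vl].
Qed.

Lemma sums_to_euler (R : realType) (q : R[i]) b : `|q| < 1 ->
  sums_to (fun m => q ^+ (b.+1 * m) / qpoch q q m) (qpoch q q b / qpoch_oo q q).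
Proof.
move=> q1; have [_ _ cv] := qpoch_cvg q1.
elim: b => [|b IHb].
  have -> : qpoch q q 0 / qpoch_oo q q = 1 + (- 1 + (qpoch_oo q q)^-1).
    by rewrite qpoch0 mul1r addrA subrr add0r.
  rewrite -[X in X + (- X + _)](_ : q ^+ (1 * 0) / qpoch q q 0 = 1); last first.
    by rewrite muln0 qpoch0 divr1.
  apply: sums_to_shift; rewrite /sums_to.
  suff -> : series (fun n => q ^+ (1 * n.+1) / qpoch q q n.+1) =
      (fun n => - (q ^+ (1 * 0) / qpoch q q 0) + (qpoch q q n)^-1).
    exact: cvg_cstD.
  apply/funext => n; rewrite -(invr_qpochE n q1) muln0 qpoch0 divr1 addrA addNr add0r.
  by apply: eq_bigr => i _; rewrite mul1n.
(* The factor [1 - q ^+ m] lowers [(q;q)_m] to [(q;q)_(m-1)], so the difference of consecutive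
   series is a shifted multiple of the first; its term at [m = 0] vanishes. *)
suff h : sums_to (fun m => q ^+ (b.+1 * m) / qpoch q q m - q ^+ (b.+2 * m) / qpoch q q m)
    (q ^+ b.+1 * (qpoch q q b / qpoch_oo q q)).
  apply: eq_sums_to (sums_toD IHb (sums_toZ (-1) h)) _ _.
    by move=> m /=; ring.
  by rewrite qpochS -exprS; ring.
have e0 : q ^+ (b.+1 * 0) / qpoch q q 0 - q ^+ (b.+2 * 0) / qpoch q q 0 = 0.
  by rewrite !muln0 subrr.
rewrite -[X in sums_to _ X]add0r -e0; apply: sums_to_shift.
apply: eq_sums_to (sums_toZ (q ^+ b.+1) IHb) _ _ => // m.
have [h1 h2] : qpoch q q m != 0 /\ 1 - q ^+ m.+1 != 0 by rewrite qpoch_neq0// subX1_neq0.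
rewrite qpochS -exprS (_ : b.+2 * m.+1 = b.+1 * m + b.+1 + m.+1)%N; last first.
  by rewrite !mulSn !mulnS; ring.
rewrite mulnSr !exprD.
set x := q ^+ m.+1 in h2 *; set y := q ^+ b.+1; set z := q ^+ (b.+1 * m).
by field; rewrite h1 h2.
Qed.

Arguments sums_to_euler {R q} b.

(** * The series [G] and its recurrences *)

(* The m-th term of G(k+1, b+1); the shifts keep the denominators nonzero and the series
   convergent. *)
Definition qlambert (K : numFieldType) (q : K) (k b m : nat) : K :=
  q ^+ (b.+1 * m) / ((1 - q ^+ (m + k).+1) * qpoch q q m).

Definition qlambert_sum (K : numFieldType) (q : K) (k b : nat) : K :=
  limn (series (qlambert q k b) : nat -> K^o).

Lemma sums_to_qlambert (R : realType) (q : R[i]) k b : `|q| < 1 ->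
  sums_to (qlambert q k b) (qlambert_sum q k b).
Proof.
move=> q1; have [C leC] := norm_qpoch_bounds q1.
have [r [qr r0 r1]] := norm_lt1_real q1.
have C0 : 0 <= C by have [/(le_trans (normr_ge0 _))] := leC 0%N; rewrite ler0c.
apply: (@cvg_series_geo _ _ (C * C * C) r) => // m.
(* Writing [1 / (1 - q ^+ (m + k).+1)] as a quotient of consecutive [q]-Pochhammer products leaves
   three factors, each bounded by [C]. *)
have -> : qlambert q k b m =
    (qpoch q q (m + k) * (qpoch q q (m + k).+1)^-1 * (qpoch q q m)^-1) * q ^+ (b.+1 * m).
  rewrite /qlambert qpochS -exprS.
  by field; rewrite subX1_neq0// !qpoch_neq0.
rewrite !normrM !(rmorphM (real_complex R)).
have -> : `|q ^+ (b.+1 * m)| = (r ^+ (b.+1 * m))%:C%C.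
  by rewrite normrX qr (rmorphXn (real_complex R)).
have r_le : r ^+ (b.+1 * m) <= r ^+ m.
  by apply: ler_wiXn2l => //; [exact: ltW | rewrite leq_pmull].
have [l1 _] := leC (m + k)%N; have [_ l2] := leC (m + k).+1; have [_ l3] := leC m.
apply: ler_pM; rewrite ?lecR ?ler0c ?mulr_ge0 ?exprn_ge0 ?normr_ge0//.
by apply: ler_pM; rewrite ?mulr_ge0 ?normr_ge0//; apply: ler_pM; rewrite ?normr_ge0.
Qed.

Arguments sums_to_qlambert {R q} k b.

(** The numerator [1 - q ^+ (m + k).+1] cancels termwise, which leaves Euler's series. *)
Lemma qlambert_sum_subZ (R : realType) (q : R[i]) k b : `|q| < 1 ->
  qlambert_sum q k b - q ^+ k.+1 * qlambert_sum q k b.+1 = qpoch q q b / qpoch_oo q q.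
Proof.
move=> q1; have h1 := sums_to_qlambert k b q1; have h2 := sums_to_qlambert k b.+1 q1.
apply: sums_to_unique (sums_to_euler b q1).
have h := sums_toD h1 (sums_toZ (- q ^+ k.+1) h2).
apply: (eq_sums_to h); last by rewrite mulNr.
move=> m /=; rewrite /qlambert.
have [e1 e2] : qpoch q q m != 0 /\ 1 - q ^+ (m + k).+1 != 0.
  by rewrite qpoch_neq0// subX1_neq0.
rewrite (_ : b.+2 * m = b.+1 * m + m)%N; last by rewrite mulSn addnC.
rewrite -addnS exprD in e2 *; rewrite exprD.
by field; rewrite e1 e2.
Qed.

(** The numerator [1 - q ^+ m] kills the term at [m = 0] and lowers [(q;q)_m]; reindexing by [m.+1]
    then raises [k] by one. *)
Lemma qlambert_sum_sub (R : realType) (q : R[i]) k b : `|q| < 1 ->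
  qlambert_sum q k b - qlambert_sum q k b.+1 = q ^+ b.+1 * qlambert_sum q k.+1 b.
Proof.
move=> q1; have h1 := sums_to_qlambert k b q1; have h2 := sums_to_qlambert k b.+1 q1.
have h3 := sums_toZ (q ^+ b.+1) (sums_to_qlambert k.+1 b q1).
pose u m := qlambert q k b m - qlambert q k b.+1 m.
have u0 : u 0 = 0 by rewrite /u /qlambert !muln0 subrr.
apply: (@sums_to_unique _ u).
  have h := sums_toD h1 (sums_toZ (-1) h2).
  apply: (eq_sums_to h).
    by move=> m; rewrite mulN1r.
  by rewrite mulN1r.
rewrite -[X in sums_to _ X]add0r -u0; apply: sums_to_shift.
apply: eq_sums_to h3 _ _ => // m; rewrite /u /qlambert.
have [[e1 e2] e3] : (qpoch q q m != 0 /\ 1 - q ^+ (m + k.+1).+1 != 0) /\ 1 - q ^+ m.+1 != 0.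
  by rewrite qpoch_neq0// !subX1_neq0.
rewrite qpochS -exprS (_ : m.+1 + k = m + k.+1)%N ?addSnnS//.
rewrite (_ : b.+2 * m.+1 = b.+1 * m + b.+1 + m.+1)%N; last by rewrite !mulSn !mulnS; ring.
rewrite mulnSr (exprD q (b.+1 * m + b.+1)) (exprD q (b.+1 * m)).
set x := q ^+ (m + k.+1).+1 in e2 *; set y := q ^+ m.+1 in e3 *.
by field; rewrite e1 e2 e3.
Qed.

(** For [k = 0] the extra denominator completes [(q;q)_m] to [(q;q)_(m+1)]: this is Euler's series
    without its initial [1]. *)
Lemma qlambert_sum0 (R : realType) (q : R[i]) b : `|q| < 1 ->
  q ^+ b.+1 * qlambert_sum q 0 b = qpoch q q b / qpoch_oo q q - 1.
Proof.
move=> q1; apply/eqP; rewrite -subr_eq opprK; apply/eqP.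
apply: sums_to_unique (sums_to_euler b q1); rewrite addrC.
rewrite [X in X + _](_ : _ = q ^+ (b.+1 * 0) / qpoch q q 0); last first.
  by rewrite muln0 qpoch0 divr1.
apply: sums_to_shift.
apply: eq_sums_to (sums_toZ (q ^+ b.+1) (sums_to_qlambert 0 b q1)) _ _ => // m.
rewrite /qlambert addn0 qpochS -exprS mulnSr exprD.
by field; rewrite subX1_neq0// qpoch_neq0.
Qed.

(** * The truncated pentagonal number theorem *)

(** The algebra of the induction step, with [Q = q ^+ k], [D = (q;q)_k], [s = (-1) ^+ k] and [y] the
    pentagonal power. [A], [A'], [A''] are [G(k+1, a)] for [a = k+2, k+3, k+4], and [B] is
    [G(k+2, k+3)]. Eliminating [B], [A''], [A'] and [S] leaves a rational identity. *)
Lemma truncated_pentagonal_step (F : fieldType) (q Q y s D P S A A' A'' B : F) :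
  q != 0 -> Q != 0 -> D != 0 -> P != 0 -> 1 - Q * q != 0 ->
  A - Q * q * A' = D * (1 - Q * q) / P ->
  A' - Q * q * A'' = D * (1 - Q * q) * (1 - Q * q * q) / P ->
  A' - A'' = Q * q * q * q * B ->
  1 + s * (y * Q ^+ 4 * q ^+ 2 / D * A) = (S - 1 - s * (y * Q ^+ 3 * q ^+ 1)) / P ->
  1 - s * (y * Q ^+ 7 * q ^+ 7 / (D * (1 - Q * q)) * B) =
  (S - s * (y * Q ^+ 3 * q ^+ 1) * (1 + Q * q) - 1 + s * (y * Q ^+ 6 * q ^+ 5)) / P.
Proof.
move=> q0 Q0 D0 P0 d0 hA hA' hB hS.
have -> : B = (A' - A'') / (Q * q * q * q) by rewrite hB; field; rewrite q0 Q0.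
have -> : A'' = (A' - D * (1 - Q * q) * (1 - Q * q * q) / P) / (Q * q).
  by rewrite -hA'; field; rewrite q0 Q0.
have -> : A' = (A - D * (1 - Q * q) / P) / (Q * q) by rewrite -hA; field; rewrite q0 Q0.
have -> : S = P * (1 + s * (y * Q ^+ 4 * q ^+ 2 / D * A)) + 1 + s * (y * Q ^+ 3 * q ^+ 1).
  by rewrite hS; field.
by field; rewrite q0 Q0 D0 P0 d0.
Qed.

(* Andrews and Merca's identity; ['C(j, 2) + j * j] is the pentagonal number j(3j-1)/2. *)
Lemma truncated_pentagonal (R : realType) (q : R[i]) k : q != 0 -> `|q| < 1 ->
  1 + (-1) ^+ k * (q ^+ ('C(k.+1, 2) + k.+1 * k.+2) / qpoch q q k * qlambert_sum q k k.+1)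
  = (\sum_(0 <= j < k.+1) (-1) ^+ j * q ^+ ('C(j, 2) + j * j) * (1 + q ^+ j) - 1
     + (-1) ^+ k.+1 * q ^+ ('C(k.+1, 2) + k.+1 * k.+1)) / qpoch_oo q q.
Proof.
move=> q0 q1; have [_ P0 _] := qpoch_cvg q1.
elim: k => [|k IHk].
  rewrite big_nat1 /= !expr0 expr1 qpoch0 divr1 !mul1r.
  have := qlambert_sum0 1 q1; rewrite qpochS qpoch0 expr0 mulr1 mul1r.
  move=> ->; by field.
have B1 : 'C(k.+1, 2) = ('C(k, 2) + k)%N by rewrite binS bin1.
have B2 : 'C(k.+2, 2) = ('C(k, 2) + k + k.+1)%N by rewrite binS bin1 B1.
(* All exponents have the same quadratic part in [k], so each power is [y * Q ^+ a * q ^+ b]. *)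
have qE n a b : n = ('C(k, 2) + k * k + a * k + b)%N ->
    q ^+ n = q ^+ ('C(k, 2) + k * k) * (q ^+ k) ^+ a * q ^+ b.
  by move=> ->; rewrite -exprM [(k * a)%N]mulnC !exprD.
have E1 := qE ('C(k.+1, 2) + k.+1 * k.+2)%N 4%N 2%N (ltac:(rewrite B1; ring)).
have E2 := qE ('C(k.+1, 2) + k.+1 * k.+1)%N 3%N 1%N (ltac:(rewrite B1; ring)).
have E3 := qE ('C(k.+2, 2) + k.+2 * k.+3)%N 7%N 7%N (ltac:(rewrite B2; ring)).
have E4 := qE ('C(k.+2, 2) + k.+2 * k.+2)%N 6%N 5%N (ltac:(rewrite B2; ring)).
rewrite big_nat_recr//= E3 E4 E2 qpochS; rewrite E1 E2 in IHk.
have sE : (-1) ^+ k.+1 = - (-1) ^+ k :> R[i] by rewrite exprS mulN1r.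
rewrite [(-1) ^+ k.+2]exprS mulN1r !sE opprK !mulNr in IHk *.
have hA := qlambert_sum_subZ k k.+1 q1; have hA' := qlambert_sum_subZ k k.+2 q1.
have hB := qlambert_sum_sub k k.+2 q1.
move: hA hA' hB IHk (subX1_neq0 k q1); rewrite !qpochS -!exprS !(exprSr _ k.+2).
rewrite !(exprSr _ k.+1) !(exprSr _ k) => hA hA' hB IH d0.
by apply: truncated_pentagonal_step hA hA' hB IH; rewrite ?expf_neq0 ?qpoch_neq0.
Qed.

(** * The series of the theorem *)

Lemma cvg_sum_shift (K : numFieldType) (f : nat -> K) k l :
  (forall n, (n < k)%N -> f n.+1 = 0) -> sums_to (fun m => f (m + k.+1)%N) l ->
  (fun N => \sum_(1 <= n < N) f n : K^o) @ \oo --> (l : K^o).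
Proof.
move=> f0 fl; rewrite -(@cvg_shiftn k.+1 K^o).
suff -> : (fun N => \sum_(1 <= n < (N + k.+1)%N) f n) = series (fun m => f (m + k.+1)%N).
  exact: fl.
apply/funext => N; rewrite (@big_cat_nat _ _ _ k.+1) ?leq_addl//=.
rewrite big_add1 big_nat big1 ?add0r => [|n /andP[_ /f0]//].
by rewrite -{1}[k.+1]add0n big_addn addnK.
Qed.

(** The [q]-binomial vanishes up to [n = k]. For [n = m + k.+1] its numerator reduces [(q;q)_n] to
    [1 - x] with [x = q ^+ n], and the bracket gives [(1 - q * x) / (1 - q)]; partial fractions
    yield the two [qlambert] terms. *)
Lemma cvg_qsummand (R : realType) (q : R[i]) k : `|q| < 1 ->
  (fun N => \sum_(1 <= n < N) qsummand q k.+1 n : R[i]^o) @ \oo -->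
  (q ^+ ('C(k.+1, 2) + k.+1 * k.+2) / qpoch q q k *
   (qlambert_sum q k k.+1 - q * qlambert_sum q k.+1 k.+1) : R[i]^o).
Proof.
move=> q1; apply: (@cvg_sum_shift _ _ k) => [n nk|].
  by rewrite /qsummand /qbinom /= leqNgt nk mulr0.
set c := _ / qpoch q q k.
have h := sums_toZ c (sums_toD (sums_to_qlambert k k.+1 q1)
  (sums_toZ (- q) (sums_to_qlambert k.+1 k.+1 q1))).
apply: (eq_sums_to h); last by rewrite mulNr.
move=> m; rewrite /qsummand /qlambert /qbinom /qbracket (addnS m k) -[(m + k).+1.-1]/(m + k)%N.
rewrite -[k.+1.-1]/k leq_addl addnK qpochS -exprS !addn1 /c.
rewrite (_ : 'C(k.+1, 2) + k.+2 * (m + k).+1 = 'C(k.+1, 2) + k.+1 * k.+2 + k.+2 * m)%N;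
  last by ring.
rewrite (exprD _ _ (k.+2 * m)).
have e1 : 1 - q != 0 by rewrite (subX1_neq0 0 q1).
have := subX1_neq0 (m + k) q1; have := subX1_neq0 (m + k).+1 q1.
have -> : q ^+ (m + k).+2 = q * q ^+ (m + k).+1 by rewrite -exprS.
set x := q ^+ (m + k).+1; set y := q ^+ (_ + _)%N; set z := q ^+ (_ * _)%N => e2 e3.
by field; rewrite e1 e2 e3 !qpoch_neq0.
Qed.

(** * Passage to the stated form *)

Lemma half_pentagonal j : ((j * (3 * j - 1))./2 = 'C(j, 2) + j * j)%N.
Proof.
(* At [j = 0] the truncated subtractions are harmless, both sides being [0]. *)
have -> : (j * (3 * j - 1) = j * j.-1 + (j * j).*2)%N.
  case: j => // j; rewrite (_ : 3 * j.+1 - 1 = 3 * j + 2)%N; last by rewrite mulnS subn1 addn2.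
  by rewrite -muln2 -[j.+1.-1]/j; ring.
by rewrite halfD odd_double andbF doubleK bin2.
Qed.

(** Here [X = q ^+ k.+1], [e] is the pentagonal power of index [k.+1], and [A], [A'], [B] are
    [G(k+1, k+2)], [G(k+1, k+3)], [G(k+2, k+2)]. The recurrences express [B] through [A], and the
    truncated theorem trades [S] for [A]. *)
Lemma truncation_to_theorem2 (F : fieldType) (q X s D P A A' B S c e : F) :
  q != 0 -> X != 0 -> D != 0 -> P != 0 -> 1 - X + X ^+ 2 != 0 -> c = e * X ->
  A - X * A' = D * (1 - X) / P ->
  A - A' = X * q * B ->
  1 + s * (c / D * A) = (S - 1 - s * e) / P ->
  X^-1 - (X ^+ 2)^-1 + (1 - X^-1 + (X ^+ 2)^-1) / P *
    (- (s * e) / (1 - X + X ^+ 2) - 1 + S) =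
  1 + s * (c / D * (A - q * B)).
Proof.
move=> q0 X0 D0 P0 d0 -> hA hB hS.
have -> : B = (A - A') / (X * q) by rewrite hB; field; rewrite q0 X0.
have -> : A' = (A - D * (1 - X) / P) / X by rewrite -hA; field; rewrite X0.
have -> : S = P * (1 + s * (e * X / D * A)) + 1 + s * e by rewrite hS; field.
by field; rewrite q0 X0 D0 P0 d0.
Qed.

(** A root would satisfy [x ^+ 3 = - 1] and so have modulus [1]. *)
Lemma subrX_sqr_neq0 (K : numFieldType) (x : K) : `|x| < 1 -> 1 - x + x ^+ 2 != 0.
Proof.
move=> x1; apply/eqP => h; have : x ^+ 3 = - 1.
  have E : x ^+ 3 + 1 = (x + 1) * (1 - x + x ^+ 2) by ring.
  by apply/eqP; rewrite -subr_eq0 opprK E h mulr0.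
move=> /(congr1 Num.norm)/eqP; rewrite normrX normrN normr1 lt_eqF//.
exact: exprn_ilt1.
Qed.

Unset Implicit Arguments.

Theorem theorem2 (R : realType) (k : nat) (q : R[i])
    (k_gt0 : (0 < k)%N) (q_neq0 : q != 0) (q_lt1 : `|q| < 1) :
  [/\ cvgn (qpoch q q : nat -> R[i]^o), qpoch_oo q q != 0,
      cvgn (fun N => \sum_(1 <= n < N) qsummand q k n : R[i]^o) &
      q ^- k - q ^- (2 * k)
      + (1 - q ^- k + q ^- (2 * k)) / qpoch_oo q q
        * ((-1) ^+ k * q ^+ (k * (3 * k - 1))./2 / (1 - q ^+ k + q ^+ (2 * k))
           - 1
           + \sum_(0 <= j < k)
               (-1) ^+ j * q ^+ (j * (3 * j - 1))./2 * (1 + q ^+ j))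
      = 1 + (-1) ^+ (k - 1)
            * limn (fun N => \sum_(1 <= n < N) qsummand q k n : R[i]^o)].
Proof.
(* From here [k.+1] stands for the [k] of the statement, matching the shifted indices of
   [qlambert]. *)
case: k k_gt0 => // k _.
have [cvP P0 _] := qpoch_cvg q_lt1; have cvS := @cvg_qsummand R q k q_lt1.
split; [exact: cvP | exact: P0 | apply/cvg_ex; eexists; exact: cvS |].
rewrite (limn_eq cvS).
under eq_bigr do rewrite half_pentagonal.
rewrite half_pentagonal subn1 /= [(2 * k.+1)%N]mulnC exprM.
have := truncated_pentagonal k q_neq0 q_lt1.
rewrite [(-1) ^+ k.+1]exprS mulN1r mulNr => tp.
have hA := qlambert_sum_subZ k k.+1 q_lt1; rewrite qpochS -exprS in hA.
have hB := qlambert_sum_sub k k.+1 q_lt1; rewrite exprSr in hB.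
apply: (truncation_to_theorem2 _ _ _ _ _ _ hA hB tp) => //; first exact: expf_neq0.
- exact: qpoch_neq0.
- by apply: subrX_sqr_neq0; rewrite normrX exprn_ilt1.
- by rewrite -exprD; congr (_ ^+ _); ring.
Qed.
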